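(* Let $K$ be a metric space and let $\varphi:\mathbb{C}\to\mathbb{C}$ be a given function. (a) If $\varphi$ is locally Lipschitz, then $\varphi\circ f\in D(K)$ for all $f\in D(K)$. (b) If conversely $K^{(n)}\neq\emptyset$ for all $n=1,2,\dots$ and $\varphi\circ f\in D(K)$ for all $f\in D(K)$, then $\varphi$ is locally Lipschitz.
   Context: $D(K)$ is the set of all $f:K\to\mathbb{C}$ of the form $f=(\varphi_1-\varphi_2)+i(\varphi_3-\varphi_4)$ with $\varphi_1,\dots,\varphi_4$ bounded real-valued lower semi-continuous functions on $K$. $\varphi:\mathbb{C}\to\mathbb{C}$ is locally Lipschitz if it is Lipschitz on every compact subset of $\mathbb{C}$. $K^{(0)}=K$, and $K^{(n+1)}$ is the set of cluster (non-isolated) points of the metric subspace $K^{(n)}$. *)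

(* Defs.v *)
From HB Require Import structures.
From mathcomp Require Import all_boot all_order all_algebra.
From mathcomp Require Import complex.
From mathcomp Require Import all_classical all_reals all_analysis.

Set Implicit Arguments.
Unset Strict Implicit.
Unset Printing Implicit Defensive.

Import Order.TTheory GRing.Theory Num.Theory.
Import numFieldNormedType.Exports.

Local Open Scope classical_set_scope.
Local Open Scope ring_scope.
Local Open Scope complex_scope.

Definition bounded_lsc {R : realType} {K : topologicalType} (g : K -> R) : Prop :=
  bounded_fun g /\ lower_semicontinuous (EFin \o g).

Definition D {R : realType} (K : topologicalType) : set (K -> R[i]) :=
  [set f | exists g1 g2 g3 g4 : K -> R,
    [/\ bounded_lsc g1, bounded_lsc g2, bounded_lsc g3, bounded_lsc g4 &
        forall x, f x = (g1 x - g2 x) +i* (g3 x - g4 x)]].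
Arguments D {R} K.

(* The normed module structure of the complex numbers is carried by R[i]^o, as for
   any numFieldType. Its norm is R[i]-valued, with `|a +i* b| the real
   (Num.sqrt (a ^+ 2 + b ^+ 2))%:C, and its topology is the usual one.
   lipschitz_on asks for a real M0 such that every M > M0 is a Lipschitz
   constant. *)
Definition locally_lipschitz {R : realType} (phi : R[i] -> R[i]) : Prop :=
  forall A : set R[i]^o, compact A ->
    [lipschitz (phi : R[i]^o -> R[i]^o) z | z in A].

(* A `&` limit_point A is the set of non-isolated points of the subspace A. *)
Definition derived_set (K : topologicalType) (n : nat) : set K :=
  iter n (fun A => A `&` limit_point A) setT.
Arguments derived_set : clear implicits.

(* Main.v *)
Require Import Defs.
From mathcomp Require Import all_boot all_order all_algebra.
From mathcomp Require Import complex.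
From mathcomp Require Import all_classical all_reals all_analysis.
From mathcomp Require Import ring lra zify.

Set Implicit Arguments.
Unset Strict Implicit.
Unset Printing Implicit Defensive.

Import Order.TTheory GRing.Theory Num.Theory.
Import numFieldNormedType.Exports.

Local Open Scope classical_set_scope.
Local Open Scope ring_scope.

(* (a) If [f] is built from bounded lower semicontinuous [g_ i] and [h] is the real
   or imaginary part of [phi], Lipschitz with constant [L] on a square containing
   the values of [f], then [h \o f + L * \sum_i g_ i] is lower semicontinuous.

   (b) Take [r : K -> nat] upper semicontinuous and unbounded such that each point
   of rank [k + 1] is a limit of points of rank [k]. If a sequence [c] has bounded
   variation, then [c \o r] is in D(K). Conversely, if [u - v = d \o r] with [u], [v]
   bounded and lower semicontinuous, then walking from rank [m] down to rank [0]
   increases [u + v] by nearly the variation of [d] up to [m], so [d] has bounded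
   variation. Hence [phi] maps sequences of bounded variation to sequences of
   bounded variation. If [phi] were not Lipschitz near [z], a sequence jumping back
   and forth between [z_ n] and [w_ n], both close to [z], the right number of times
   for each [n], would contradict this. *)

(** * The l1 norm on the complex numbers *)

Section ComplexL1Norm.
Variable R : realType.
Implicit Types z w : R[i].

(** Equivalent to the modulus, but with values in [R] and additive over real and imaginary parts, so
    that estimates become linear arithmetic. *)
Definition normc1 z : R := `|complex.Re z| + `|complex.Im z|.

Lemma normc1_ge0 z : 0 <= normc1 z.
Proof. by rewrite addr_ge0. Qed.

Lemma normc1_eq0 z : normc1 z = 0 -> z = 0.
Proof.
case: z => a b /eqP; rewrite /normc1 /= paddr_eq0 // !normr_eq0.
by case/andP => /eqP -> /eqP ->.
Qed.

Lemma normc1N z : normc1 (- z) = normc1 z.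
Proof. by case: z => a b; rewrite /normc1 /= !normrN. Qed.

Lemma ler_normc1D z w : normc1 (z + w) <= normc1 z + normc1 w.
Proof.
case: z w => a b [c d]; rewrite /normc1 /=.
have := ler_normD a c; have := ler_normD b d; lra.
Qed.

Lemma normc1_distC z w : normc1 (z - w) = normc1 (w - z).
Proof. by rewrite -normc1N opprB. Qed.

Lemma normc1_dist_triangle x z w :
  normc1 (z - w) <= normc1 (z - x) + normc1 (x - w).
Proof. by apply: le_trans (ler_normc1D _ _); rewrite addrA subrK. Qed.

Lemma norm_le_normc1 z : `|z| <= ((normc1 z)%:C)%C.
Proof.
rewrite normc_def lecR -[leRHS](ger0_norm (normc1_ge0 z)) -sqrtr_sqr.
rewrite ler_wsqrtr // /normc1 sqrrD !real_normK ?num_real //.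
have : 0 <= `|complex.Re z| * `|complex.Im z| by rewrite mulr_ge0.
by lra.
Qed.

Lemma normc1_le_norm z : ((normc1 z)%:C)%C <= 2 * `|z|.
Proof.
rewrite /normc1 rmorphD /= mulr_natl mulr2n lerD ?normc_ge_Re //.
by rewrite normc_def lecR -sqrtr_sqr ler_wsqrtr // lerDr sqr_ge0.
Qed.

End ComplexL1Norm.

(** * Differences of bounded lower semicontinuous functions, and implication (a) *)

Section SemicontinuousDifferences.
Variable R : realType.

Lemma bounded_funP (T : Type) (g : T -> R) :
  bounded_fun g <-> exists M : R, forall x, `|g x| <= M.
Proof.
split=> [[M0 [_ gM]]|[M gM]].
  by exists (M0 + 1) => x; apply: (gM (M0 + 1)) => //; rewrite ltrDl.
exists M; split; first exact: num_real.
by move=> N MN x _; apply: le_trans (gM x) (ltW MN).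
Qed.

Variable K : topologicalType.
Implicit Types g h : K -> R.

Lemma bounded_lscP g : bounded_lsc g <->
  (exists M : R, forall x, `|g x| <= M) /\
  (forall x e, 0 < e -> \forall y \near x, g x - e < g y).
Proof.
rewrite /bounded_lsc bounded_funP; split=> -[gM lsc]; split=> //.
  move=> x e e0; have [|V xV VP] := lsc x (g x - e).
    by rewrite lte_fin gtrBl.
  by apply: filterS xV => y /VP; rewrite lte_fin.
move=> x a; rewrite /= lte_fin => agx.
exists [set y | a < g y]; last by move=> y; rewrite /= lte_fin.
have /(lsc x) : 0 < g x - a by rewrite subr_gt0.
by apply: filterS => y; rewrite subKr.
Qed.

Definition dbsc h := exists u v, [/\ bounded_lsc u, bounded_lsc v &
  forall x, h x = u x - v x].

Lemma D_dbsc (f : K -> R[i]) :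
  D K f <-> dbsc (fun x => complex.Re (f x)) /\ dbsc (fun x => complex.Im (f x)).
Proof.
split=> [[g1 [g2 [g3 [g4 [h1 h2 h3 h4 fE]]]]]|].
  by split; [exists g1, g2|exists g3, g4]; split=> // x; rewrite fE.
move=> [[g1 [g2 [h1 h2 fRe]]] [g3 [g4 [h3 h4 fIm]]]].
exists g1, g2, g3, g4; split=> // x; rewrite -fRe -fIm.
by case: (f x).
Qed.

(* Where some [g_ i] jumps up, the increment of [L * g_ i] pays for the
   variation of [h], so [h + L * \sum_i g_ i] is lower semicontinuous. *)
Lemma dbsc_dominated (I : finType) (g_ : I -> K -> R) h L : 0 <= L ->
  (forall i, bounded_lsc (g_ i)) ->
  (forall x y, `|h x - h y| <= L * \sum_i `|g_ i x - g_ i y|) -> dbsc h.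
Proof.
move=> L0 gP hL.
have [B gB] : {B : I -> R & forall i x, `|g_ i x| <= B i}.
  apply: (choice (P := fun i B => forall x, `|g_ i x| <= B)) => i.
  by have /bounded_lscP[] := gP i.
have [H hH] : exists H, forall x, `|h x| <= H.
  have [[x0 _]|nK] := pselect (exists x : K, True); last first.
    by exists 0 => x; case: nK; exists x.
  exists (`|h x0| + L * \sum_i (B i + B i)) => x.
  rewrite -[h x](subrK (h x0)) addrC; apply: le_trans (ler_normD _ _) _.
  rewrite lerD2l; apply: le_trans (hL _ _) _; rewrite ler_wpM2l //.
  by apply: ler_sum => i _; apply: le_trans (ler_normB _ _) _; apply: lerD.
have GB x : `|L * \sum_i g_ i x| <= L * \sum_i B i.
  rewrite normrM (ger0_norm L0) ler_wpM2l //.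
  by apply: le_trans (ler_norm_sum _ _ _) _; apply: ler_sum.
(* [|t| - t] is twice the negative part of [t], so only drops of the [g_ i] count, and near [x] each
   is below [e / (2 * L * n + 1)]. *)
have glsc x e : 0 < e -> \forall y \near x,
    L * \sum_i (`|g_ i y - g_ i x| - (g_ i y - g_ i x)) < e.
  move=> e0; pose n : R := #|I|%:R.
  have n0 : 0 <= n by rewrite ler0n.
  have Ln0 : 0 < 2 * L * n + 1 by rewrite ltr_wpDl // !mulr_ge0.
  have : \forall y \near x, forall i, g_ i x - e / (2 * L * n + 1) < g_ i y.
    apply: filter_forall => i; have /bounded_lscP[_] := gP i; apply.
    by rewrite divr_gt0.
  apply: filterS => y gy.
  apply: (@le_lt_trans _ _ (L * \sum_(i : I) (2 * (e / (2 * L * n + 1))))).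
    rewrite ler_wpM2l //; apply: ler_sum => i _.
    have d0 : 0 < e / (2 * L * n + 1) by rewrite divr_gt0.
    have := gy i; have [_|_] := ler0P (g_ i y - g_ i x); lra.
  rewrite sumr_const -[X in L * X]mulr_natl -/n.
  have -> : L * (n * (2 * (e / (2 * L * n + 1)))) =
            e - e / (2 * L * n + 1) by field; apply: lt0r_neq0.
  by rewrite gtrBl divr_gt0.
have sumB x y : L * \sum_i (`|g_ i y - g_ i x| - (g_ i y - g_ i x)) =
    L * \sum_i `|g_ i y - g_ i x| - (L * \sum_i g_ i y - L * \sum_i g_ i x).
  by rewrite !sumrB !mulrBr.
exists (fun x => h x + L * \sum_i g_ i x), (fun x => L * \sum_i g_ i x).
split=> [||x]; last by rewrite addrK.
- apply/bounded_lscP; split.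
    exists (H + L * \sum_i B i) => x.
    by apply: le_trans (ler_normD _ _) _; apply: lerD.
  move=> x e e0; apply: filterS (glsc x e e0) => y.
  rewrite sumB; have := hL y x; rewrite ler_norml => /andP[+ _].
  lra.
- apply/bounded_lscP; split; first by exists (L * \sum_i B i).
  move=> x e e0; apply: filterS (glsc x e e0) => y; rewrite sumB.
  have : 0 <= L * \sum_i `|g_ i y - g_ i x| by rewrite mulr_ge0 // sumr_ge0.
  lra.
Qed.

Lemma compact_square (r : R) :
  compact ([set z | `|complex.Re z| <= r /\ `|complex.Im z| <= r] : set R[i]^o).
Proof.
have -> : [set z : R[i]^o | `|complex.Re z| <= r /\ `|complex.Im z| <= r] =
    (fun p : R * R => (p.1 +i* p.2)%C) @` (`[- r, r] `*` `[- r, r]).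
  apply/seteqP; split=> [[a b] /= []|_ [[a b] [/= + +] <-]] /=.
    by rewrite !ler_norml => ar br; exists (a, b) => //=; rewrite !in_itv.
  by rewrite !in_itv /= !ler_norml.
apply: continuous_compact; last first.
  by apply: compact_setX; exact: segment_compact.
apply: continuous_subspaceT => -[a b]; apply/(@cvgrPdist_le _ R[i]^o) => e.
rewrite ltcE /= => /andP[/eqP e2 e1].
have d0 : 0 < complex.Re e / 2 by rewrite divr_gt0.
exists (ball a (complex.Re e / 2), ball b (complex.Re e / 2)).
  by split; exact: nbhsx_ballx.
move=> [c d] [/= ac bd]; apply: le_trans (norm_le_normc1 _) _.
rewrite lecE /= e2 eqxx /= /normc1 /=.
move: ac bd; rewrite /ball /=; lra.
Qed.

Lemma D_lipschitz_comp (phi : R[i] -> R[i]) (f : K -> R[i]) :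
  locally_lipschitz phi -> D K f -> D K (phi \o f).
Proof.
move=> lip [g1 [g2 [g3 [g4 [h1 h2 h3 h4 fE]]]]].
pose g_ (i : 'I_4) : K -> R := nth g1 [:: g1; g2; g3; g4] i.
have gP i : bounded_lsc (g_ i) by case: i => -[|[|[|[|//]]]].
have [M fM] : exists M : R, forall x,
    `|complex.Re (f x)| <= M /\ `|complex.Im (f x)| <= M.
  move: (h1) (h2) (h3) (h4) => /bounded_lscP[[M1 M1P] _] /bounded_lscP[[M2 M2P] _]
    /bounded_lscP[[M3 M3P] _] /bounded_lscP[[M4 M4P] _].
  exists (M1 + M2 + M3 + M4) => x; rewrite fE /=.
  have := ler_normB (g1 x) (g2 x); have := ler_normB (g3 x) (g4 x).
  have := M1P x; have := M2P x; have := M3P x; have := M4P x.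
  have := normr_ge0 (g1 x); have := normr_ge0 (g2 x); have := normr_ge0 (g3 x).
  have := normr_ge0 (g4 x); lra.
have /lip/pinfty_ex_gt0[L L0 LP] := @compact_square M.
have {L L0 LP} [L L0 LP] : exists2 L : R, 0 <= L & forall x y,
    `|phi (f x) - phi (f y)| <= ((L * normc1 (f x - f y))%:C)%C.
  (* A positive element of [R[i]] has zero imaginary part, so the Lipschitz constant is real. *)
  move: L0 LP; rewrite ltcE /=; case: L => L L' /= /andP[/eqP -> L0] LP.
  exists L => [|x y]; first exact: ltW.
  apply: le_trans (LP (f x, f y) _) _ => //=.
  rewrite rmorphM ler_wpM2l ?norm_le_normc1 // lecE /= eqxx ltW //.
have fg x y : normc1 (f x - f y) <= \sum_i `|g_ i x - g_ i y|.
  rewrite !big_ord_recl big_ord0 /= !fE /normc1 /g_ /=.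
  have := ler_normB (g1 x - g1 y) (g2 x - g2 y).
  have := ler_normB (g3 x - g3 y) (g4 x - g4 y).
  rewrite [X in `|X|](_ : _ = g3 x - g4 x - (g3 y - g4 y)); last by ring.
  rewrite [X in _ -> `|X| <= _ -> _](_ : _ = g1 x - g2 x - (g1 y - g2 y)); last by ring.
  lra.
apply/D_dbsc; split; apply: (dbsc_dominated L0 gP) => x y /=;
  (apply: (@le_trans _ _ (L * normc1 (f x - f y))); last by rewrite ler_wpM2l);
  rewrite -lecR; apply: le_trans (LP x y).
- have := normc_ge_Re (phi (f x) - phi (f y)).
  by case: (phi _) (phi _) => a b [].
- rewrite normc_def lecR -sqrtr_sqr ler_wsqrtr //.
  by case: (phi _) (phi _) => a b [c d] /=; rewrite lerDr sqr_ge0.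
Qed.

End SemicontinuousDifferences.

(** * From Lipschitz near every point to Lipschitz on compact sets *)

Section LocallyLipschitz.
Variables (R : realType) (phi : R[i] -> R[i]).

Definition lipschitz_near (z : R[i]) := exists2 e : R, 0 < e &
  exists M, forall w w', normc1 (w - z) < e -> normc1 (w' - z) < e ->
    normc1 (phi w - phi w') <= M * normc1 (w - w').

Lemma nbhs_normc1 (z : R[i]^o) (e : R) : 0 < e ->
  nbhs z [set w | normc1 (w - z) < e].
Proof.
move=> e0; apply/nbhs_ballP; exists ((e / 2)%:C)%C => /=.
  by rewrite ltcR divr_gt0.
move=> w /=; rewrite /ball /= => zw.
rewrite -ltcR normc1_distC; apply: le_lt_trans (normc1_le_norm _) _.
by rewrite [e]splitr rmorphD /= mulr_natl mulr2n ltrD.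
Qed.

(** Near every pair of points the inequality holds for all large constants: on the diagonal by
    hypothesis, off it because [phi] is locally bounded while the distance stays away from 0.
    Compactness of the square of [A] makes the constant uniform. *)
Lemma lipschitz_near_locally :
  (forall z, lipschitz_near z) -> locally_lipschitz phi.
Proof.
move=> lip A cA.
have /compact_near_coveringP cov := compact_setX cA cA.
pose P (M : R[i]) (p : R[i]^o * R[i]^o) :=
  `|phi p.1 - phi p.2| <= M * `|p.1 - p.2|.
suff loc (p : R[i]^o * R[i]^o) : (A `*` A) p ->
    \forall p' \near p & M \near +oo, P M p'.
  exact: (cov _ _ P _ loc).
case: p => z w _.
suff [e e0 [M MP]] : exists2 e, 0 < e & exists M : R, forall z' w',
    normc1 (z' - z) < e -> normc1 (w' - w) < e ->
    normc1 (phi z' - phi w') <= M * normc1 (z' - w').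
  exists ([set p' | normc1 (p'.1 - z) < e /\ normc1 (p'.2 - w) < e],
          [set N | ((2 * `|M|)%:C)%C < N]); first split => /=.
  - exists ([set z' | normc1 (z' - z) < e], [set w' | normc1 (w' - w) < e]).
      by split; exact: nbhs_normc1.
    by move=> [z' w'].
  - exists ((2 * `|M|)%:C)%C; split=> //.
    by rewrite complex_real.
  move=> [[z' w'] N] [/= [ze we]] MN.
  rewrite /P /=; apply: le_trans (norm_le_normc1 _) _.
  apply: (@le_trans _ _ ((`|M| * normc1 (z' - w'))%:C)%C).
    rewrite lecR; apply: le_trans (MP _ _ ze we) _.
    by rewrite ler_wpM2r ?normc1_ge0 ?ler_norm.
  apply: (@le_trans _ _ (((2 * `|M|)%:C)%C * `|z' - w'|)); last first.
    by rewrite ler_wpM2r // ltW.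
  rewrite [2 * _]mulrC !rmorphM /= rmorph_nat -mulrA ler_wpM2l ?lecR //.
  exact: normc1_le_norm.
have [e1 e10 [M1 M1P]] := lip z; have [e2 e20 [M2 M2P]] := lip w.
have [<-|zw] := eqVneq z w; first by exists e1 => //; exists M1.
have d0 : 0 < normc1 (z - w).
  rewrite lt_neqAle normc1_ge0 andbT eq_sym.
  by apply: contra zw => /eqP/normc1_eq0/eqP; rewrite subr_eq0.
(* The quarter keeps [z'] and [w'] at least half the distance of [z] and [w] apart; [B] then bounds
   [normc1 (phi z' - phi w')] by way of [phi z] and [phi w]. *)
exists (Num.min (Num.min e1 e2) (normc1 (z - w) / 4)).
  by rewrite !lt_min e10 e20 divr_gt0.
pose B := `|M1| * e1 + normc1 (phi z - phi w) + `|M2| * e2.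
have B0 : 0 <= B.
  by rewrite !addr_ge0 ?mulr_ge0 ?normc1_ge0 // ltW.
exists (B / (normc1 (z - w) / 2)) => z' w'.
rewrite !lt_min => /andP[/andP[z1 _] z4] /andP[/andP[_ w2] w4].
have zw' : normc1 (z - w) / 2 <= normc1 (z' - w').
  have := normc1_dist_triangle z' z w; have := normc1_dist_triangle w' z' w.
  rewrite (normc1_distC z z'); lra.
apply: (@le_trans _ _ B); last first.
  by rewrite mulrAC ler_pdivlMr ?divr_gt0 // ler_wpM2l.
have := normc1_dist_triangle (phi z) (phi z') (phi w').
have := normc1_dist_triangle (phi w) (phi z) (phi w').
have : normc1 (phi z' - phi z) <= `|M1| * e1.
  apply: le_trans (M1P _ _ z1 _) _; first by rewrite subrr /normc1 /= normr0 addr0.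
  apply: (@le_trans _ _ (`|M1| * normc1 (z' - z))).
    by rewrite ler_wpM2r ?normc1_ge0 ?ler_norm.
  by rewrite ler_wpM2l // ltW.
have : normc1 (phi w - phi w') <= `|M2| * e2.
  rewrite normc1_distC; apply: le_trans (M2P _ _ w2 _) _.
    by rewrite subrr /normc1 /= normr0 addr0.
  apply: (@le_trans _ _ (`|M2| * normc1 (w' - w))).
    by rewrite ler_wpM2r ?normc1_ge0 ?ler_norm.
  by rewrite ler_wpM2l // ltW.
rewrite /B; lra.
Qed.

End LocallyLipschitz.

(** * Functions of the rank and sequences of bounded variation *)

Section RankFunctions.
Variables (R : realType) (K : topologicalType).

(** A condition at a single point, because glued ranks are controlled only away from the centre of
    the gluing. *)
Definition rank_at (r : K -> nat) (y : K) :=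
  (\forall z \near y, (r z <= r y)%N) /\
  (forall k, r y = k.+1 -> forall U, nbhs y U -> exists2 z, U z & r z = k).

(* [E] is the set of points of infinite rank. *)
Variables (r : K -> nat) (E : set K).
Hypothesis closedE : closed E.
Hypothesis rankP : forall y, ~ E y -> rank_at r y.

Let near_notE y : ~ E y -> \forall z \near y, ~ E z.
Proof.
move=> Ey; have : open (~` E) by rewrite openC.
by rewrite openE => /(_ y Ey).
Qed.

(** Near a point outside [E] the rank does not increase and [p] is nonincreasing, so the function
    does not drop; on [E] it takes a lower bound of all its values. *)
Lemma bounded_lsc_rank (p : nat -> R) (L : R) :
  (forall j, L <= p j.+1 <= p j) ->
  bounded_lsc (fun y => if y \in E then L else p (r y)).
Proof.
move=> pP.
have pL j : L <= p j by case/andP: (pP j) => *; apply: le_trans; eassumption.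
have pmono i j : (i <= j)%N -> p j <= p i.
  move=> /subnK <-; elim: (j - i)%N => // n; apply: le_trans.
  by rewrite addSn; case/andP: (pP (n + i)%N).
apply/bounded_lscP; split.
  exists (`|L| + `|p 0|) => y; case: ifP => _; first by rewrite lerDl.
  have := pL (r y); have := pmono 0 (r y) isT.
  have := ler_norm (p 0); have := ler_norm (- L); rewrite normrN ler_norml.
  have := normr_ge0 L; have := normr_ge0 (p 0); lra.
move=> x e e0; case: ifPn; rewrite ?inE ?notin_setE => xE.
  near=> y; case: ifP => _; first by rewrite gtrBl.
  by have := pL (r y); lra.
have [rx _] := rankP xE; apply: filterS2 rx (near_notE xE) => y ry Ey.
case: ifPn; rewrite ?inE ?notin_setE // => _.
by have := pmono _ _ ry; lra.
Unshelve. all: by end_near. Qed.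

(** A Jordan decomposition: [V] bounds the variation still to come, so [a + V] and [V] are both
    nonincreasing. *)
Lemma dbsc_rank (a V : nat -> R) : (forall j, 0 <= V j) ->
  (forall j, `|a j.+1 - a j| <= V j - V j.+1) ->
  dbsc (fun y => if y \in E then a 0 - V 0 else a (r y)).
Proof.
move=> V0 aV.
exists (fun y => if y \in E then a 0 - V 0 else a (r y) + V (r y)).
exists (fun y => if y \in E then 0 else V (r y)).
(* [a - V] is nondecreasing and [V] nonnegative, so [a 0 - V 0] is a lower bound of [a + V], as the
   value on [E] must be. *)
have aVP j : a j - V j >= a 0 - V 0.
  elim: j => // j IH; apply: le_trans IH _.
  by have := aV j; rewrite ler_norml => /andP[]; lra.
split; last by move=> y; case: ifP => _; [rewrite subr0 | rewrite addrK].
- apply: (@bounded_lsc_rank (fun j => a j + V j)) => j.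
  have := aVP j.+1; have := V0 j.+1.
  have := aV j; rewrite ler_norml => /andP[]; lra.
- apply: bounded_lsc_rank => j; rewrite V0 /=.
  by have := aV j; have := normr_ge0 (a j.+1 - a j); lra.
Qed.

(* Near a point neither [u] nor [v] drops by much, so a jump of [u - v] forces an
   increase of [u + v] by almost the same amount. *)
Lemma rank_descent (u v : K -> R) (d : nat -> R) (e : R) m y :
  bounded_lsc u -> bounded_lsc v -> 0 < e ->
  (forall z, ~ E z -> d (r z) = u z - v z) -> ~ E y -> r y = m ->
  exists z, u y + v y + \sum_(j < m) `|d j.+1 - d j| - e *+ m <= u z + v z.
Proof.
move=> /bounded_lscP[_ lu] /bounded_lscP[_ lv] e0 duv.
elim: m y => [|m IH] y Ey ry.
  by exists y; rewrite big_ord0 mulr0n addr0 subr0.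
have [_ /(_ m ry) rk] := rankP Ey.
have e20 : 0 < e / 2 by rewrite divr_gt0.
have [|z [Ez uz vz] rz] :=
    rk [set z | [/\ ~ E z, u y - e / 2 < u z & v y - e / 2 < v z]].
  by near do split; [apply: near_notE|apply: lu|apply: lv].
have [w wP] := IH z Ez rz; exists w; apply: le_trans wP.
rewrite big_ord_recr /= mulrSr.
have := duv z Ez; have := duv y Ey; rewrite ry rz => -> ->.
by have [_|_] := ler0P (u y - v y - (u z - v z)); lra.
Unshelve. all: by end_near. Qed.

Lemma dbsc_rank_variation (h : K -> R) (d : nat -> R) : dbsc h ->
  (forall y, ~ E y -> h y = d (r y)) ->
  (forall m, exists2 y, ~ E y & (m <= r y)%N) ->
  exists C, forall m, \sum_(j < m) `|d j.+1 - d j| <= C.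
Proof.
move=> [u [v [bu bv huv]]] hd runb.
have [[Mu uM] _] := (bounded_lscP u).1 bu.
have [[Mv vM] _] := (bounded_lscP v).1 bv.
(* [2 * (Mu + Mv)] bounds the oscillation of [u + v]; the [1] covers the total loss of a descent of
   [r y] steps, each losing the inverse of [(r y).+1]. *)
exists (2 * (Mu + Mv) + 1) => m; have [y Ey my] := runb m.
have e0 : 0 < (r y).+1%:R^-1 :> R by rewrite invr_gt0.
have duv z : ~ E z -> d (r z) = u z - v z by move=> Ez; rewrite -huv hd.
have [z] := rank_descent bu bv e0 duv Ey erefl.
have : (r y).+1%:R^-1 *+ r y <= 1 :> R.
  by rewrite -[leLHS]mulr_natl ler_pdivrMr // mul1r ler_nat.
have : \sum_(j < m) `|d j.+1 - d j| <= \sum_(j < r y) `|d j.+1 - d j|.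
  rewrite -(subnKC my) big_split_ord /= lerDl sumr_ge0 //.
move: (uM y) (uM z) (vM y) (vM z).
rewrite !ler_norml => /andP[+ +] /andP[+ +] /andP[+ +] /andP[+ +].
move: (_ *+ _) (\sum_(j < m) _) (\sum_(j < r y) _) => x1 x2 x3.
lra.
Qed.

Lemma D_rank_variation (phi : R[i] -> R[i]) (c : nat -> R[i]) (V : nat -> R) :
  (forall m, exists2 y, ~ E y & (m <= r y)%N) ->
  (forall f : K -> R[i], D K f -> D K (phi \o f)) ->
  (forall j, 0 <= V j) ->
  (forall j, normc1 (c j.+1 - c j) <= V j - V j.+1) ->
  exists C, forall m, \sum_(j < m) normc1 (phi (c j.+1) - phi (c j)) <= C.
Proof.
move=> runb phiD V0 cV.
pose cRe j := complex.Re (c j); pose cIm j := complex.Im (c j).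
have ReB z w : complex.Re (z - w : R[i]) = complex.Re z - complex.Re w.
  by case: z w => ? ? [].
have ImB z w : complex.Im (z - w : R[i]) = complex.Im z - complex.Im w.
  by case: z w => ? ? [].
(* On [E], the real and imaginary parts take the values that [dbsc_rank] prescribes. *)
pose f y := if y \in E then ((cRe 0 - V 0) +i* (cIm 0 - V 0))%C else c (r y).
have /phiD/D_dbsc[dRe dIm] : D K f.
  apply/D_dbsc; split.
    rewrite (_ : (fun _ => _) =
      fun y => if y \in E then cRe 0 - V 0 else cRe (r y)).
      apply: dbsc_rank => // j; apply: le_trans (cV j).
      by rewrite /normc1 ReB lerDl.
    by apply/funext => y; rewrite /f; case: ifP.
  rewrite (_ : (fun _ => _) =
    fun y => if y \in E then cIm 0 - V 0 else cIm (r y)).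
    apply: dbsc_rank => // j; apply: le_trans (cV j).
    by rewrite /normc1 ImB lerDr.
  by apply/funext => y; rewrite /f; case: ifP.
have fc y : ~ E y -> f y = c (r y).
  by rewrite /f; case: ifPn => //; rewrite inE.
have [|C1 C1P] := dbsc_rank_variation (d := fun j => complex.Re (phi (c j))) dRe _ runb.
  by move=> y Ey /=; rewrite fc.
have [|C2 C2P] := dbsc_rank_variation (d := fun j => complex.Im (phi (c j))) dIm _ runb.
  by move=> y Ey /=; rewrite fc.
exists (C1 + C2) => m; rewrite big_split /=.
by apply: lerD; [have := C1P m|have := C2P m]; apply: le_trans;
  apply: ler_sum => j _; rewrite ?ReB ?ImB.
Qed.

End RankFunctions.

(** * Maps preserving bounded variation are Lipschitz near every point *)

Section BoundedVariation.
Variables (R : realType) (phi : R[i] -> R[i]).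

(* The positions of a sequence cut into blocks, the [n]-th one having [N n + 1]
   terms: [(n, i)] is the [i]-th position in the [n]-th block. *)
Definition block_step (N : nat -> nat) (s : nat * nat) : nat * nat :=
  if (s.2 < N s.1)%N then (s.1, s.2.+1) else (s.1.+1, 0%N).

Definition block_pos (N : nat -> nat) (j : nat) := iter j (block_step N) (0, 0)%N.

Lemma block_pos_shift N n i j : block_pos N j = (n, 0)%N -> (i <= N n)%N ->
  block_pos N (i + j) = (n, i).
Proof.
move=> jn; elim: i => // i IH iN.
by rewrite addSn /block_pos iterS -/(block_pos N _) IH 1?ltnW // /block_step iN.
Qed.

Lemma block_pos_start N n : exists j, block_pos N j = (n, 0)%N.
Proof.
elim: n => [|n [j jn]]; first by exists 0%N.
exists (N n + j).+1; rewrite /block_pos iterS -/(block_pos N _).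
by rewrite (block_pos_shift jn) // /block_step /= ltnn.
Qed.

(** Otherwise, for each [n], some pair within [q n] of [z] is stretched by more than the inverse
    square of [q n]. About [q n / d n] jumps between its two points have variation of order [q n],
    which is summable, but their images have variation at least [(q n)^-1]. *)
Lemma bounded_variation_lipschitz_near :
  (forall (c : nat -> R[i]) (V : nat -> R), (forall j, 0 <= V j) ->
    (forall j, normc1 (c j.+1 - c j) <= V j - V j.+1) ->
    exists C, forall m, \sum_(j < m) normc1 (phi (c j.+1) - phi (c j)) <= C) ->
  forall z, lipschitz_near phi z.
Proof.
move=> bv z; apply: contrapT => nlip.
pose q n : R := 2^-1 ^+ n.
have q0 n : 0 < q n by rewrite exprn_gt0.
have qS n : q n.+1 = q n / 2 by rewrite /q exprSr.
have /choice[w_ wP] : forall n, exists w : R[i] * R[i],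
    [/\ normc1 (w.1 - z) < q n, normc1 (w.2 - z) < q n &
      (q n)^-1 * (q n)^-1 * normc1 (w.1 - w.2) < normc1 (phi w.1 - phi w.2)].
  move=> n; apply: contrapT => nw; apply: nlip; exists (q n) => //.
  exists ((q n)^-1 * (q n)^-1) => w w' wz w'z; rewrite leNgt; apply/negP => lt.
  by apply: nw; exists (w, w').
pose d n := normc1 ((w_ n).1 - (w_ n).2).
have d0 n : 0 < d n.
  rewrite lt_neqAle normc1_ge0 andbT eq_sym; apply/eqP => /normc1_eq0/eqP.
  have [_ _] := wP n; rewrite subr_eq0 => + /eqP ww.
  by rewrite ww !subrr /normc1 /= normr0 addr0 mulr0 ltxx.
have d2 n : d n <= 2 * q n.
  have [w1 w2 _] := wP n; have := normc1_dist_triangle z (w_ n).1 (w_ n).2.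
  rewrite (normc1_distC z) -/(d n); lra.
pose N n := (Num.truncn (q n / d n)).+1.
have NP n : q n <= (N n)%:R * d n <= 3 * q n.
  have /truncn_itv/andP[le lt] : 0 <= q n / d n by rewrite divr_ge0 // ltW.
  rewrite -ler_pdivrMr // (ltW lt) /= /N mulrSr mulrDl mul1r.
  move: le; rewrite ler_pdivlMr // => le; have := d2 n; lra.
pose cc (s : nat * nat) := if odd s.2 then (w_ s.1).2 else (w_ s.1).1.
(* After the jumps left in block [n], [8 * q n] pays for the rest: at most [3/2 * q n] to reach the
   next block, [3/2 * q n] inside it, and [8 * q n.+1 = 4 * q n] from there on. *)
pose V (s : nat * nat) := (N s.1 - s.2)%:R * d s.1 + 8 * q s.1.
have ccz s : normc1 (cc s - z) <= q s.1.
  by rewrite /cc; have [w1 w2 _] := wP s.1; case: ifP => _; apply: ltW.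
have ccS n i (f : R[i] -> R[i]) : normc1 (f (cc (n, i.+1)) - f (cc (n, i))) =
    normc1 (f (w_ n).1 - f (w_ n).2).
  by rewrite /cc /=; case: (odd i) => //=; rewrite normc1_distC.
have stepP s : normc1 (cc (block_step N s) - cc s) <= V s - V (block_step N s).
  case: s => n i; rewrite /block_step /=; case: ltnP => iN.
    rewrite (ccS _ _ id) /V /= -/(d n) -(subnSK iN) mulrSr; lra.
  have := normc1_dist_triangle z (cc (n.+1, 0%N)) (cc (n, i)).
  rewrite (normc1_distC z).
  have := ccz (n.+1, 0%N); have := ccz (n, i).
  have iN0 : (N n - i = 0)%N by apply/eqP; rewrite subn_eq0.
  rewrite /V /= iN0 mul0r subn0 qS.
  have := NP n.+1; rewrite qS => /andP[_].
  have := q0 n; lra.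
have [||C CP] := bv (cc \o block_pos N) (V \o block_pos N).
- by move=> j; rewrite addr_ge0 // mulr_ge0 // ltW.
- by move=> j; exact: stepP.
pose n := (Num.truncn `|C|).+1.
have Cq : C < (q n)^-1.
  rewrite /q exprVn invrK -natrX; apply: le_lt_trans (ler_norm C) _.
  have /truncn_itv/andP[_ lt] := normr_ge0 C; apply: lt_le_trans lt _.
  by rewrite ler_nat ltnW // ltn_expl.
have [j jn] := block_pos_start N n.
have := CP (j + N n)%N; apply/negP; rewrite -ltNge.
(* Only the [N n] jumps inside block [n] are kept; since [N n * d n] is at least [q n], their images
   already exceed [C]. *)
rewrite big_split_ord /=; apply: ltr_wpDl.
  by rewrite sumr_ge0 // => i _; rewrite normc1_ge0.
rewrite (eq_bigr (fun=> normc1 (phi (w_ n).1 - phi (w_ n).2))); last first.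
  move=> i _; rewrite -/(block_pos N _) [(j + i)%N]addnC.
  by rewrite -iterS -/(block_pos N _) -addSn !(block_pos_shift jn) ?ccS // ltnW.
rewrite sumr_const card_ord -[ltRHS]mulr_natl.
apply: lt_le_trans Cq _.
have [_ _ /ltW] := wP n; rewrite -/(d n) => le.
apply: le_trans (ler_wpM2l (ler0n _ _) le).
rewrite mulrCA -mulrA ler_pMr ?invr_gt0 //.
by rewrite mulrC ler_pdivlMr // mul1r; case/andP: (NP n).
Qed.

End BoundedVariation.

(** * Construction of an unbounded rank on a metric space *)

Section RankConstruction.
Variables (R : realType) (K : metricType R).
Local Notation d := (@mdist R K).

Let near_mdist (x : K) (e : R) : 0 < e -> \forall y \near x, d x y < e.
Proof. by move=> e0; apply/nbhs_ballP; exists e => // y; rewrite ballEmdist. Qed.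

Let nbhs_mdist_ex (x : K) U : nbhs x U ->
  exists2 e : R, 0 < e & forall y, d x y < e -> U y.
Proof. by move=> /nbhs_ballP[e e0]; rewrite ballEmdist; exists e. Qed.

Lemma rank_at_local (r r' : K -> nat) z :
  (\forall w \near z, r w = r' w) -> rank_at r z -> rank_at r' z.
Proof.
move=> rr' [rle rk]; have rz := nbhs_singleton rr'; split.
  by apply: filterS2 rr' rle => w <-; rewrite -rz.
move=> k; rewrite -rz => rzk U zU.
have [w [Uw rw] rwk] := rk k rzk _ (filterI zU rr').
by exists w => //; rewrite -rw.
Qed.

(* The pieces live in pairwise disjoint annuli around [x], so that away from [x]
   the glued function locally agrees with a single piece. *)
Lemma rank_glue (x : K) (e : R) (v : nat) (k : nat -> nat) : 0 < e ->
  (forall n (h : R), 0 < h -> exists y, 0 < d x y < h /\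
    forall s : R, 0 < s -> exists r : K -> nat, [/\ forall z, rank_at r z, r y = k n,
      forall z, (r z <= k n)%N & forall z, s <= d y z -> r z = 0%N]) ->
  exists (r : K -> nat) (y_ : nat -> K),
    [/\ r x = v, forall z, z != x -> rank_at r z,
      forall n, 0 < d x (y_ n) < e * 2^-1 ^+ n /\ r (y_ n) = k n,
      forall z, z != x -> exists n, (r z <= k n)%N &
      forall z, e <= d x z -> r z = 0%N].
Proof.
move=> e0 H.
have /choice[Y YP] : forall p : nat * R, exists y, 0 < p.2 -> 0 < d x y < p.2 /\
    forall s : R, 0 < s -> exists r : K -> nat, [/\ forall z, rank_at r z, r y = k p.1,
      forall z, (r z <= k p.1)%N & forall z, s <= d y z -> r z = 0%N].
  move=> [n h] /=; have [h0|h0] := ltP 0 h; last by exists x.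
  by have [y yP] := H n h h0; exists y.
(* Each centre is less than half as far from [x] as the previous one, which separates the annuli;
   starting within [e / 2] keeps all of them in the ball of radius [e]. *)
pose y_ := fix y_ n := if n is m.+1 then Y (n, d x (y_ m) / 2) else Y (0%N, e / 2).
pose t n := d x (y_ n).
have t0 n : 0 < t n.
  elim: n => [|n IH]; rewrite /t /=.
    by case: (YP (0%N, e / 2)) => [|/andP[]] //=; rewrite divr_gt0.
  by case: (YP (n.+1, t n / 2)) => [|/andP[]] //=; rewrite divr_gt0.
have tS n : t n.+1 < t n / 2.
  by case: (YP (n.+1, t n / 2)) => [|/andP[]] //=; rewrite divr_gt0.
have te n : t n < e / 2 * 2^-1 ^+ n.
  elim: n => [|n IH].
    by rewrite mulr1; case: (YP (0%N, e / 2)) => [|/andP[]] //=; rewrite divr_gt0.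
  by rewrite exprSr mulrA; have := tS n; lra.
have tlt m n : (m < n)%N -> t n < t m / 2.
  elim: n => // n IH; rewrite ltnS leq_eqVlt => /predU1P[->//|/IH].
  by have := tS n; have := t0 n; lra.
have /choice[rho rhoP] : forall n, exists r : K -> nat, [/\ forall z, rank_at r z,
    r (y_ n) = k n, forall z, (r z <= k n)%N &
    forall z, t n / 8 <= d (y_ n) z -> r z = 0%N].
  have t8 n : 0 < t n / 8 by rewrite divr_gt0.
  case=> [|n]; last by case: (YP (n.+1, t n / 2)) => [|_] /=; [rewrite divr_gt0|apply].
  by case: (YP (0%N, e / 2)) => [|_] /=; [rewrite divr_gt0|apply].
(* The annulus contains the ball of radius [t n / 8] about [y_ n], outside of which [rho n]
   vanishes. *)
pose A n (z : K) := `|(d x z : R) - t n| < t n / 8.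
(* For [m < n], distances to [x] in the two annuli have ratio above [(7/8) / (9/16) = 14/9], but
   inside the shell around [D] ratios stay below [11/9]. *)
have A_uniq (D : R) m n w w' : 0 < D -> D * 9 / 10 < d x w < D * 11 / 10 ->
    D * 9 / 10 < d x w' < D * 11 / 10 -> A m w -> A n w' -> m = n.
  move=> D0 /andP[w1 w2] /andP[w3 w4]; rewrite /A !ltr_norml => /andP[a1 a2] /andP[a3 a4].
  by case: (ltngtP m n) => // /tlt ?; exfalso; lra.
have rho0 n z : ~ A n z -> rho n z = 0%N.
  move=> /negP; rewrite -leNgt => nA; have [_ _ _] := rhoP n; apply.
  apply: le_trans nA _; rewrite ler_norml /t.
  have := metric_triangle x (y_ n) z; have := metric_triangle x z (y_ n).
  rewrite (metric_sym z); lra.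
pose r z := if z == x then v else
  if pselect (exists n, A n z) is left ex then rho (projT1 (cid ex)) z else 0%N.
have r_local z : z != x -> exists n, \forall w \near z, rho n w = r w.
  move=> zx; have D0 : 0 < d x z by rewrite mdist_gt0 eq_sym.
  pose W := [set w | d x z * 9 / 10 < d x w < d x z * 11 / 10].
  have zW : nbhs z W.
    have d0 : 0 < d x z / 10 by rewrite divr_gt0.
    apply: filterS (near_mdist z d0) => w zw; rewrite /W /=.
    have := metric_triangle x z w; have := metric_triangle x w z.
    by rewrite (metric_sym w); lra.
  have Wx w : W w -> w == x = false.
    by apply: contraPF => /eqP ->; rewrite /W /= mdistxx; lra.
  (* The shell [W] meets at most one annulus. If it meets [A N], then [r] is [rho N] on all of [W];
     if it meets none, [r] and [rho 0] are both zero there. *)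
  have [[N [w0 [Ww0 Aw0]]]|nA] := pselect (exists N w, W w /\ A N w).
    exists N; apply: filterS zW => w Ww; rewrite /r Wx //.
    case: pselect => [ex|nex]; last by rewrite rho0 // => Aw; apply: nex; exists N.
    case: cid => /= n An.
    by rewrite (A_uniq (d x z) N n w0 w).
  exists 0%N; apply: filterS zW => w Ww; rewrite /r Wx //.
  case: pselect => [[n An]|nex]; first by case: nA; exists n, w.
  by rewrite rho0 // => Aw; apply: nex; exists 0%N.
exists r, y_; split.
- by rewrite /r eqxx.
- move=> z /r_local[n nr]; apply: rank_at_local nr _.
  by have [] := rhoP n.
- move=> n; split.
    apply/andP; split; [exact: t0|apply: lt_le_trans (te n) _].
    by rewrite ler_wpM2r ?exprn_ge0 //; lra.
  have yx : y_ n == x = false by apply/negbTE; rewrite eq_sym -mdist_gt0 t0.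
  have An : A n (y_ n) by rewrite /A subrr normr0 divr_gt0.
  rewrite /r yx; case: pselect => [ex|]; last by case; exists n.
  case: cid => /= m Am.
  have tn : t n * 9 / 10 < d x (y_ n) < t n * 11 / 10.
    by rewrite -/(t n); have := t0 n; lra.
  by rewrite (A_uniq (t n) m n (y_ n) (y_ n)) //; have [] := rhoP n.
- by move=> z /r_local[n /nbhs_singleton <-]; exists n; have [] := rhoP n.
- move=> z ez; rewrite /r.
  have -> : z == x = false.
    by apply/negbTE; rewrite eq_sym -mdist_gt0; apply: lt_le_trans ez.
  case: pselect => // ex; case: (cid ex) => /= m.
  rewrite {1}/A ltr_norml => /andP[_ Am]; exfalso.
  have : t m < e / 2.
    apply: lt_le_trans (te m) _; apply: ler_piMr; first by rewrite ltW ?divr_gt0.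
    by rewrite exprn_ile1 // ?invr_ge0 ?invf_le1 ?ler1n.
  by lra.
Qed.

(** By induction, trees of rank [j] are glued around points of the [j]-th derived set converging to
    [x], and [x] receives rank [j.+1]. Vanishing outside a given ball lets a tree fit into an
    annulus of the next gluing. *)
Lemma rank_tree j (x : K) (e : R) : derived_set K j x -> 0 < e ->
  exists r : K -> nat, [/\ forall z, rank_at r z, r x = j,
    forall z, (r z <= j)%N & forall z, e <= d x z -> r z = 0%N].
Proof.
elim: j x e => [|j IH] x e.
  move=> _ e0; exists (fun=> 0%N); split=> // z; split=> //.
  exact: nearW.
rewrite /derived_set iterS -/(derived_set K j) => -[_ xlim] e0.
have [n h h0|r [y_ [rx rz ry rle re]]] := @rank_glue x e j.+1 (fun=> j) e0.
  have [y [yx yj yh]] := xlim _ (near_mdist x h0).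
  exists y; split; first by rewrite mdist_gt0 eq_sym yx.
  by move=> s s0; exact: IH.
have {}rle z : (r z <= j.+1)%N.
  have [->|/rle[_]] := eqVneq z x; first by rewrite rx.
  exact: leqW.
exists r; split=> // z; have [->|] := eqVneq z x; last exact: rz.
split; first by rewrite rx; exact: nearW.
rewrite rx => _ [<-] U /nbhs_mdist_ex[h h0 hU].
(* Since [2 ^ n > n], this [n] brings [y_ n] within [h] of [x]. *)
pose n := (Num.truncn (e / h)).+1.
have [/andP[_ yn] ryn] := ry n; exists (y_ n) => //; apply: hU.
apply: lt_le_trans yn _; rewrite exprVn ler_pdivrMr ?exprn_gt0 //.
rewrite -ler_pdivrMl // mulrC -natrX.
have /truncn_itv/andP[_ lt] : 0 <= e / h by rewrite divr_ge0 // ltW.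
by apply: le_trans (ltW lt) _; rewrite ler_nat ltnW // ltn_expl.
Qed.

Lemma closed_derived_set n : closed (derived_set K n).
Proof.
elim: n => [|n IH]; first exact: closedT.
rewrite /derived_set iterS -/(derived_set K n) => y yn.
have yD : derived_set K n y.
  by apply: IH => U /yn[w [[Dw _] Uw]]; exists w.
split=> // U /[dup] yU /yn[w [[Dw wlim] Uw]].
have [wy|wy] := eqVneq w y; last by exists w.
by move: wlim; rewrite wy; apply.
Qed.

Lemma derived_set_le m n : (m <= n)%N -> derived_set K n `<=` derived_set K m.
Proof.
move=> /subnK <-; elim: (n - m)%N => // i IH y.
by rewrite addSn /derived_set iterS => -[/IH].
Qed.

(* If some point lies in all the derived sets then trees of growing rank are
   glued around it; otherwise the Cantor-Bendixson rank does. *)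
Lemma unbounded_rank : (forall n, (1 <= n)%N -> derived_set K n !=set0) ->
  exists (r : K -> nat) (E : set K), [/\ closed E, forall y, ~ E y -> rank_at r y &
    forall m, exists2 y, ~ E y & (m <= r y)%N].
Proof.
move=> ne.
have [[q qP]|nq] := pselect (exists q, forall n, derived_set K n q).
  (* Pieces of rank [0], [1], [2], ... accumulate at [q], which forms [E]; its value [0] is a
     default. *)
  have [n h h0|r [y_ [_ rz ry _ _]]] := @rank_glue q 1 0 id ltr01.
    have := qP n.+1; rewrite /derived_set iterS -/(derived_set K n) => -[_ qlim].
    have [y [yq yn yh]] := qlim _ (near_mdist q h0).
    exists y; split; first by rewrite mdist_gt0 eq_sym yq.
    by move=> s s0; exact: rank_tree.
  exists r, [set q]; split.
  - exact: accessible_closed_set1 (hausdorff_accessible (@metric_hausdorff _ K)) _.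
  - by move=> y /eqP; exact: rz.
  - move=> m; have [/andP[ym _] rm] := ry m; exists (y_ m); last by rewrite rm.
    by move=> /= yq; move: ym; rewrite yq mdistxx ltxx.
have fin y : exists n, ~~ `[< derived_set K n y >].
  apply: contrapT => /forallNP yn; apply: nq; exists y => n.
  by apply/asboolP/negPn/negP; exact: yn.
(* The last derived set containing [y]; the minimum is positive because [derived_set K 0] is
   everything. *)
pose r y := (ex_minn (fin y)).-1.
have rP y n : derived_set K n y <-> (n <= r y)%N.
  rewrite /r; case: ex_minnP => m /asboolPn nm mmin.
  have m0 : (0 < m)%N by case: m nm {mmin} => // -[].
  split=> [Dn|nm'].
    rewrite -ltnS prednK // ltnNge; apply/negP => mn.
    by apply: nm; apply: derived_set_le mn _ _.
  apply: contrapT => /asboolPn /mmin; lia.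
exists r, set0; split; first exact: closed0.
- move=> y _; split.
    have ny : (~` derived_set K (r y).+1) y by move=> /rP; rewrite ltnn.
    have : open (~` derived_set K (r y).+1).
      by rewrite openC; exact: closed_derived_set.
    rewrite openE => /(_ y ny); apply: filterS => z nD.
    by rewrite leqNgt; apply/negP => /rP.
  move=> k ry U yU; apply: contrapT => nU.
  (* Without points of rank [k] in [U], the points of the [k]-th derived set in [U] all lie in the
     next one, so [y] would be a limit of that one and have rank at least [k.+2]. *)
  suff /rP : derived_set K k.+2 y by rewrite ry ltnn.
  have Dy : derived_set K k.+1 y by apply/rP; rewrite ry.
  rewrite /derived_set iterS -/(derived_set K k.+1); split=> // W yW.
  move: Dy; rewrite {1}/derived_set iterS -/(derived_set K k) => -[_ ylim].
  have [z [zy Dz [Uz Wz]]] := ylim _ (filterI yU yW).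
  exists z; split=> //; apply/rP; rewrite ltn_neqAle; apply/andP; split; last exact/rP.
  by apply/eqP => kz; apply: nU; exists z.
- move=> m; have [y Dy] := ne m.+1 isT; exists y => //.
  by apply/rP; apply: derived_set_le Dy.
Qed.

End RankConstruction.

(** * Both implications assembled *)

Theorem proposition2p8 (R : realType) (K : metricType R)
    (phi : R[i] -> R[i]) :
  (locally_lipschitz phi -> forall f : K -> R[i], D K f -> D K (phi \o f)) /\
  ((forall n, (1 <= n)%N -> derived_set K n !=set0) ->
   (forall f : K -> R[i], D K f -> D K (phi \o f)) ->
   locally_lipschitz phi).
Proof.
split=> [lip f|ne phiD]; first exact: D_lipschitz_comp.
have [r [E [closedE rP runb]]] := unbounded_rank ne.
apply: lipschitz_near_locally; apply: bounded_variation_lipschitz_near => c V.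
exact: D_rank_variation closedE rP phi c V runb phiD.
Qed.
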